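(* Let $D$ be a weakly quasi-transitive digraph. Then $D$ is semi-strict chordal if and only if $S(D)$ is semi-strict chordal and $D$ does not contain any digraph in the family $\mathcal{F}_1$ (types (a), (b), (c), (d)) as an induced subdigraph.
   Context: Digraphs are finite with at least one vertex, have no loops and no multiple arcs, but may contain digons (pairs of arcs joining two vertices in opposite directions). An arc contained in a digon is symmetric; otherwise it is non-symmetric. Two vertices are adjacent (neighbours) if there is at least one arc between them. $N^-(v)$, $N^+(v)$ denote the sets of in-neighbours and out-neighbours of $v$ (counting both symmetric and non-symmetric arcs). A vertex $v$ of a digraph $D$ is semi-strict di-simplicial if for any $u\in N^-(v)$ and $w\in N^+(v)$ with $u\neq w$, both $uw$ and $wu$ are arcs of $D$. A digraph is semi-strict chordal if every induced subdigraph of it contains a semi-strict di-simplicial vertex. $S(D)$ is the spanning subdigraph of $D$ whose arc set consists of all symmetric arcs of $D$. Neighbours $u,w$ of $v$ are synchronous neighbours of $v$ if $u,w$ are both in $N^-(v)\setminus N^+(v)$, or both in $N^+(v)\setminus N^-(v)$, or both in $N^-(v)\cap N^+(v)$; otherwise they are asynchronous neighbours of $v$. $D$ is weakly quasi-transitive if for each vertex $v$, any two asynchronous neighbours of $v$ are adjacent. Family $\mathcal{F}_1$: in each of the following, ''$x\to y$'' means $xy$ is an arc and $yx$ is not; ''$x\leftrightarrow y$'' means both $xy$ and $yx$ are arcs; ''$x,y$ joined by a single arc'' means exactly one of $xy,yx$ is an arc, with unspecified direction. (a) Vertices $1,2,3,4$ with $1\leftrightarrow 3$, $2\leftrightarrow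 4$; $1,2$ joined by a single arc; $3,4$ joined by a single arc; $2,3$ adjacent in any way (single arc in either direction or digon); $4,1$ adjacent in any way. (b) Vertices $1,2,3,4$ with $1\leftrightarrow 4$, $1\leftrightarrow 3$, $2\to 3$, $4\to 3$, $4\to 2$, and $1,2$ joined by a single arc. (c) Vertices $1,2,3,4$ with $3\leftrightarrow 4$, $2\to 3$, $4\to 1$, $1\to 3$, $4\to 2$, and $1,2$ joined by a single arc. (d) Vertices $1,2,3$ with $1\to 2$, $2\to 3$, $3\to 1$. Every digraph obtained by any choice of the unspecified adjacencies belongs to $\mathcal{F}_1$. *)

(* Defs.v *)
From mathcomp Require Import all_boot.
Set Implicit Arguments.
Unset Strict Implicit.
Unset Printing Implicit Defensive.

(* [darc u v]: there is an arc from u to v. *)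
Record digraph := Digraph {
  vertex :> finType;
  darc : rel vertex;
  darc_irreflexive : irreflexive darc;
  vertex_nonempty : 0 < #|vertex| }.
Arguments darc {d} _ _.

Section Digraphs.
Variable D : digraph.
Implicit Types u v w : D.

Definition in_nbrs v : {set D} := [set u | darc u v].
Definition out_nbrs v : {set D} := [set w | darc v w].

Definition adjacent u v : bool := darc u v || darc v u.
Definition digon u v : bool := darc u v && darc v u.
Definition one_way u v : bool := darc u v && ~~ darc v u.
Definition single_arc u v : bool := one_way u v || one_way v u.

Definition semi_strict_disimplicial v : Prop :=
  forall u w, u \in in_nbrs v -> w \in out_nbrs v -> u != w ->
    darc u w /\ darc w u.

Definition synchronous v u w : bool :=
  [|| (u \in in_nbrs v :\: out_nbrs v) && (w \in in_nbrs v :\: out_nbrs v),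
      (u \in out_nbrs v :\: in_nbrs v) && (w \in out_nbrs v :\: in_nbrs v)
    | (u \in in_nbrs v :&: out_nbrs v) && (w \in in_nbrs v :&: out_nbrs v)].

Definition asynchronous v u w : bool :=
  [&& adjacent u v, adjacent w v & ~~ synchronous v u w].

Definition weakly_quasi_transitive : Prop :=
  forall v u w, asynchronous v u w -> adjacent u w.

End Digraphs.

Section Induced.
Variables (D : digraph) (A : {set D}) (A_neq0 : A != set0).

Definition induced_darc : rel {x : D | x \in A} :=
  fun x y => darc (val x) (val y).

Fact induced_darc_irreflexive : irreflexive induced_darc.
Proof. by move=> x; apply: darc_irreflexive. Qed.

Fact induced_vertex_nonempty : 0 < #|{: {x : D | x \in A}}|.
Proof. by rewrite card_sig card_gt0. Qed.

Definition induced : digraph :=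
  Digraph induced_darc_irreflexive induced_vertex_nonempty.
End Induced.

Definition semi_strict_chordal (D : digraph) : Prop :=
  forall (A : {set D}) (A_neq0 : A != set0),
    exists v : induced A_neq0, semi_strict_disimplicial v.

Fact digon_irreflexive (D : digraph) : irreflexive (@digon D).
Proof. by move=> x; rewrite /digon darc_irreflexive. Qed.

(* The digraph S(D) of symmetric arcs. *)
Definition symmetric_part (D : digraph) : digraph :=
  Digraph (@digon_irreflexive D) (vertex_nonempty D).

(* D has an induced subdigraph isomorphic to H. *)
Definition contains_induced (D H : digraph) : Prop :=
  exists2 f : H -> D, injective f & forall x y, darc (f x) (f y) = darc x y.

Section FamilyF1.
Variable H : digraph.

(* With the cardinality condition, v1, ..., v4 are all the vertices of H. *)
Definition F1_type_a : Prop :=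
  #|H| = 4 /\ exists v1 v2 v3 v4 : H, uniq [:: v1; v2; v3; v4] /\
    [&& digon v1 v3, digon v2 v4, single_arc v1 v2, single_arc v3 v4,
        adjacent v2 v3 & adjacent v4 v1].

Definition F1_type_b : Prop :=
  #|H| = 4 /\ exists v1 v2 v3 v4 : H, uniq [:: v1; v2; v3; v4] /\
    [&& digon v1 v4, digon v1 v3, one_way v2 v3, one_way v4 v3,
        one_way v4 v2 & single_arc v1 v2].

Definition F1_type_c : Prop :=
  #|H| = 4 /\ exists v1 v2 v3 v4 : H, uniq [:: v1; v2; v3; v4] /\
    [&& digon v3 v4, one_way v2 v3, one_way v4 v1, one_way v1 v3,
        one_way v4 v2 & single_arc v1 v2].

Definition F1_type_d : Prop :=
  #|H| = 3 /\ exists v1 v2 v3 : H, uniq [:: v1; v2; v3] /\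
    [&& one_way v1 v2, one_way v2 v3 & one_way v3 v1].

Definition family_F1 : Prop :=
  [\/ F1_type_a, F1_type_b, F1_type_c | F1_type_d].

End FamilyF1.

(* Main.v *)
Require Import Defs.
From mathcomp Require Import all_boot.

(** Necessity is local: the symmetric arcs at a vertex that is disimplicial in
    D[A] already make it simplicial in the graph S(D)[A], and no member of F1
    has a disimplicial vertex ([F1_no_disimplicial]), while every induced
    subdigraph of a semi-strict chordal digraph has one.

    For sufficiency, fix a nonempty set A of vertices. Without single arcs in
    D[A], a simplicial vertex of S(D)[A] is disimplicial. Otherwise consider the
    ends of single arcs of D[A]. Weak quasi-transitivity says that the other
    vertices do not tell the two ends of a single arc apart: a vertex z that is
    not an end of a single arc and forms a digon with one end of a single arc
    forms a digon with the other end as well ([digon_to_clean]).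

    Call an end of a single arc lonely if it forms digons only with vertices
    that are not ends of single arcs. The proof looks for a disimplicial
    vertex among the lonely ones.

    - Lonely vertices exist ([exists_lonely]): let m have the largest number of
      digons among the ends of single arcs. Excluding type (a) makes the
      digon-neighbourhoods of the ends of a single arc nested, and then
      chordality of S(D) and type (a) again show that whatever is joined to m by
      a single arc is lonely.

    - At a lonely vertex y every condition for being disimplicial that involves
      a digon at y holds by chordality and [digon_to_clean]. What remains is
      that u and w form a digon whenever u -> y -> w
      ([lonely_disimplicial]).

    - This remaining condition holds for y if neither u nor w is lonely
      ([one_way_lonely_path]), by types (a), (b) and (d).

    - By type (d), one-way arcs between lonely vertices are a strict order. Let
      y be minimal for it. If y is not disimplicial there are c -> y -> w with c
      not lonely, hence w lonely; take t maximal among the lonely vertices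
      above y. If t has no one-way out-neighbour, it is disimplicial; otherwise
      t -> c' with c' not lonely, and c, c', y, t form type (c). *)

(** * Adjacency and disimplicial vertices of vertex sets *)

Section Adjacency.
Set Implicit Arguments.
Unset Strict Implicit.
Variable D : digraph.
Implicit Types (u v w x y z : D) (A : {set D}).

Definition disimplicial_in A v : Prop :=
  forall u w, u \in A -> w \in A -> darc u v -> darc v w -> u != w -> digon u w.

(** Replaces induced subdigraphs, whose vertices live in a sigma type, by sets
    of vertices of D itself. *)
Lemma chordalP :
  semi_strict_chordal D <->
  forall A, A != set0 -> exists2 v, v \in A & disimplicial_in A v.
Proof.
split=> [chD A A_neq0 | disA A A_neq0].
  have [v v_dis] := chD A A_neq0; exists (val v); first exact: valP.
  move=> u w uA wA uv vw neq_uw.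
  have [] := v_dis (Sub u uA : induced A_neq0) (Sub w wA : induced A_neq0).
  - by rewrite inE.
  - by rewrite inE.
  - by rewrite -val_eqE.
  by rewrite /digon => uw wu; apply/andP.
have [v vA v_dis] := disA A A_neq0; exists (Sub v vA : induced A_neq0).
move=> u w; rewrite !inE => uv vw neq_uw.
exact: andP (v_dis _ _ (valP u) (valP w) uv vw neq_uw).
Qed.

Lemma digonC u v : digon u v = digon v u.
Proof. exact: andbC. Qed.

Lemma digon_sym u v : digon u v -> digon v u.
Proof. by rewrite digonC. Qed.

Lemma single_arcC u v : single_arc u v = single_arc v u.
Proof. exact: orbC. Qed.

Lemma adjacentC u v : adjacent u v = adjacent v u.
Proof. exact: orbC. Qed.

Lemma digon_adjacent u v : digon u v -> adjacent u v.
Proof. by rewrite /adjacent => /andP[->]. Qed.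

Lemma single_adjacent u v : single_arc u v -> adjacent u v.
Proof. by rewrite /adjacent => /orP[] /andP[-> //]; rewrite orbT. Qed.

Lemma single_not_digon u v : single_arc u v -> ~~ digon u v.
Proof.
by rewrite /single_arc /one_way /digon; case: (darc u v); case: (darc v u).
Qed.

Lemma adjacent_single u v : adjacent u v -> ~~ digon u v -> single_arc u v.
Proof.
rewrite /single_arc /one_way /digon /adjacent.
by case: (darc u v); case: (darc v u).
Qed.

Lemma one_way_single u v : one_way u v -> single_arc u v.
Proof. by rewrite /single_arc => ->. Qed.

Lemma darc_one_way u v : darc u v -> ~~ digon u v -> one_way u v.
Proof. by rewrite /digon /one_way => ->. Qed.

Lemma single_neq {u v} : single_arc u v -> u != v.
Proof.
by apply: contraTneq => ->; rewrite /single_arc /one_way darc_irreflexive.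
Qed.

Lemma digon_neq {u v} : digon u v -> u != v.
Proof. by apply: contraTneq => ->; rewrite /digon darc_irreflexive. Qed.

End Adjacency.

(** * The family F1 has no disimplicial vertices *)

Section Obstructions.
Set Implicit Arguments.
Unset Strict Implicit.
Variable H : digraph.
Implicit Types u v w x y : H.

Lemma digon_obstruction v x y :
  digon v x -> adjacent v y -> single_arc x y -> ~ semi_strict_disimplicial v.
Proof.
move=> /andP[vx xv] adj xy v_dis; case/negP: (single_not_digon xy); apply/andP.
case/orP: adj => [vy|yv]; first by apply: v_dis; rewrite ?inE ?single_neq.
by have [] := v_dis y x; rewrite ?inE // eq_sym single_neq.
Qed.

Lemma path_obstruction v u w :
  one_way u v -> one_way v w -> single_arc u w -> ~ semi_strict_disimplicial v.
Proof.
move=> /andP[uv _] /andP[vw _] uw v_dis; case/negP: (single_not_digon uw).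
by apply/andP/v_dis; rewrite ?inE ?single_neq.
Qed.

Lemma uniq_cover (s : seq H) : uniq s -> #|H| = size s -> forall v, v \in s.
Proof.
move=> /card_uniqP card_s cardH v.
have /subset_cardP/(_ (subset_predT _)) eq_s : #|s| = #|H|.
  by rewrite card_s cardH.
by rewrite eq_s.
Qed.

(** Each vertex is ruled out either by a digon at it whose other end meets a
    further neighbour in a single arc ([digon_obstruction]), or as the middle
    of a one-way path whose ends are joined by a single arc
    ([path_obstruction]). *)
Lemma F1_no_disimplicial :
  family_F1 H -> forall v : H, ~ semi_strict_disimplicial v.
Proof.
case=> [] [cardH].
- case=> v1 [v2 [v3 [v4 [Us]]]] /and5P[d13 d24 s12 s34 /andP[a23 a41]] v.
  have := uniq_cover Us cardH v; rewrite !inE => /or4P[] /eqP->.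
  + by apply: (@digon_obstruction v1 v3 v4); rewrite // adjacentC.
  + by apply: (@digon_obstruction v2 v4 v3); rewrite // single_arcC.
  + by apply: (@digon_obstruction v3 v1 v2); rewrite 1?(digonC, adjacentC).
  + by apply: (@digon_obstruction v4 v2 v1); rewrite 1?(digonC, single_arcC).
- case=> v1 [v2 [v3 [v4 [Us]]]] /and5P[d14 d13 o23 o43 /andP[o42 s12]] v.
  have [s43 s42 s23] := And3 (one_way_single o43) (one_way_single o42)
                             (one_way_single o23).
  have := uniq_cover Us cardH v; rewrite !inE => /or4P[] /eqP->.
  + by apply: (@digon_obstruction v1 v4 v3); rewrite // digon_adjacent.
  + exact: (@path_obstruction v2 v4 v3).
  + apply: (@digon_obstruction v3 v1 v2); rewrite 1?digonC //.
    by rewrite adjacentC single_adjacent.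
  + apply: (@digon_obstruction v4 v1 v2); rewrite 1?digonC //.
    exact: single_adjacent.
- case=> v1 [v2 [v3 [v4 [Us]]]] /and5P[d34 o23 o41 o13 /andP[o42 s12]] v.
  have [s23 s41 s13 s42] := And4 (one_way_single o23) (one_way_single o41)
                                 (one_way_single o13) (one_way_single o42).
  have := uniq_cover Us cardH v; rewrite !inE => /or4P[] /eqP->.
  + case/orP: s12 => [o12|o21]; first exact: (@path_obstruction v1 v4 v2).
    exact: (@path_obstruction v1 v2 v3).
  + case/orP: s12 => [o12|o21]; first exact: (@path_obstruction v2 v1 v3).
    exact: (@path_obstruction v2 v4 v1).
  + apply: (@digon_obstruction v3 v4 v1) => //.
    by rewrite adjacentC single_adjacent.
  + apply: (@digon_obstruction v4 v3 v1); rewrite 1?(digonC, single_arcC) //.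
    exact: single_adjacent.
case=> v1 [v2 [v3 [Us]]] /and3P[o12 o23 o31] v.
have [s12 s23 s31] := And3 (one_way_single o12) (one_way_single o23)
                           (one_way_single o31).
have := uniq_cover Us cardH v; rewrite !inE => /or3P[] /eqP->.
+ by apply: (@path_obstruction v1 v3 v2); rewrite // single_arcC.
+ by apply: (@path_obstruction v2 v1 v3); rewrite // single_arcC.
+ by apply: (@path_obstruction v3 v2 v1); rewrite // single_arcC.
Qed.

End Obstructions.

(** * Necessity *)

Section Necessity.
Set Implicit Arguments.
Unset Strict Implicit.
Variable D : digraph.
Hypothesis chD : semi_strict_chordal D.

Lemma chordal_symmetric_part : semi_strict_chordal (symmetric_part D).
Proof.
apply/chordalP => A A_neq0.
have [v vA v_dis] := (chordalP D).1 chD A A_neq0.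
exists v => // u w uA wA /andP[uv _] /andP[vw _] neq_uw.
have uw := v_dis _ _ uA wA uv vw neq_uw.
by apply/andP; split; rewrite // /darc /= digonC.
Qed.

Lemma chordal_contains_disimplicial (H : digraph) :
  contains_induced D H -> exists v : H, semi_strict_disimplicial v.
Proof.
case=> f f_inj fE.
have imf_neq0 : f @: [set: H] != set0.
  by rewrite imset_eq0 -cards_eq0 cardsT -lt0n vertex_nonempty.
have [_ /imsetP[v _ ->] v_dis] := (chordalP D).1 chD _ imf_neq0.
exists v => u w; rewrite !inE => uv vw neq_uw; apply/andP.
rewrite -!fE; apply: v_dis; rewrite ?imset_f ?inE ?fE //.
by rewrite (inj_eq f_inj).
Qed.

End Necessity.

(** * Configurations excluded by the family F1 *)

Section ForbiddenConfigurations.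
Set Implicit Arguments.
Unset Strict Implicit.
Variable D : digraph.
Hypothesis D_wqt : weakly_quasi_transitive D.
Hypothesis F1_free : forall H : digraph, family_F1 H -> ~ contains_induced D H.
Implicit Types a b c d p q r u v w x y z : D.

(** The members of F1 are digraphs on exactly three or four named vertices: the
    sequence [t] names, in the induced subdigraph, the vertices listed in
    [s]. *)
Lemma induced_on_seq (s : seq D) : uniq s -> s != [::] ->
  exists (H : digraph) (f : H -> D) (t : seq H),
    [/\ injective f, forall h k : H, darc (f h) (f k) = darc h k,
        #|H| = size s & map f t = s].
Proof.
move=> Us s_neq0; have s_nonempty : [set x in s] != set0.
  case: s s_neq0 {Us} => // x s _; apply/set0Pn; exists x.
  by rewrite !inE eqxx.
exists (induced s_nonempty), val, (pmap insub s); split=> //.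
- exact: val_inj.
- by rewrite card_sig /= -(card_uniqP Us); apply: eq_card => x; rewrite !inE.
rewrite (pmap_filter (insubK _)); apply/all_filterP/allP => x xs.
by rewrite /= isSome_insub inE.
Qed.

Lemma single_digon_adjacent u v w :
  single_arc u v -> digon v w -> adjacent u w.
Proof.
move=> uv vw; apply: (@D_wqt v).
move: uv vw; rewrite /asynchronous /synchronous !inE.
rewrite /adjacent /single_arc /one_way /digon.
by do 4!case: (darc _ _).
Qed.

Lemma one_way_path_adjacent u v w : one_way u v -> one_way v w -> adjacent u w.
Proof.
move=> uv vw; apply: (@D_wqt v).
move: uv vw; rewrite /asynchronous /synchronous !inE /adjacent /one_way.
by do 4!case: (darc _ _).
Qed.

(** The two adjacencies left free in type (a) hold by weak quasi-transitivity,
    and the four vertices are distinct because a single arc is not a digon. *)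
Lemma no_alternating_cycle a b c d :
  digon a c -> digon b d -> single_arc a b -> ~~ single_arc c d.
Proof.
move=> ac bd ab; apply/negP => cd.
have bc : adjacent b c.
  by apply: (@single_digon_adjacent b a) => //; rewrite single_arcC.
have da : adjacent d a by rewrite adjacentC (@single_digon_adjacent a b).
have Us : uniq [:: a; b; c; d].
  rewrite /= !inE !negb_or (single_neq ab) (digon_neq ac) (digon_neq bd).
  rewrite (single_neq cd) !andbT /=; apply/andP; split.
    by apply: contraTneq (single_not_digon ab) => ->; rewrite digonC bd.
  by apply: contraTneq (single_not_digon ab) => ->; rewrite ac.
have [H [f [t [f_inj fE cardH ft]]]] := induced_on_seq Us isT.
case: t ft => [|v1 [|v2 [|v3 [|v4 [|]]]]] //= [e1 e2 e3 e4].
subst a b c d.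
apply: (@F1_free H); last by exists f.
apply: Or41; split=> //; exists v1, v2, v3, v4.
rewrite -(map_inj_uniq f_inj); split=> //.
move: ac bd ab cd bc da; rewrite /digon /single_arc /one_way /adjacent !fE.
by do 6!move=> ->.
Qed.

Lemma no_type_b p q r y :
  digon p q -> digon p r -> one_way q r -> one_way q y -> one_way y r ->
  single_arc p y -> False.
Proof.
move=> pq pr qr qy yr py.
have Us : uniq [:: p; y; r; q].
  rewrite /= !inE !negb_or (single_neq py) (digon_neq pr) (digon_neq pq).
  by rewrite -![_ == q]eq_sym !single_neq // one_way_single.
have [H [f [t [f_inj fE cardH ft]]]] := induced_on_seq Us isT.
case: t ft => [|v1 [|v2 [|v3 [|v4 [|]]]]] //= [e1 e2 e3 e4].
subst p y r q; apply: (@F1_free H); last by exists f.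
apply: Or42; split=> //; exists v1, v2, v3, v4.
rewrite -(map_inj_uniq f_inj); split=> //.
move: pq pr yr qr qy py; rewrite /digon /single_arc /one_way !fE.
by do 6!move=> ->.
Qed.

Lemma no_type_c q r y z :
  digon q r -> one_way q y -> one_way q z -> one_way y r -> one_way z r ->
  ~~ single_arc y z.
Proof.
move=> qr qy qz yr zr; apply/negP => yz.
have Us : uniq [:: y; z; r; q].
  rewrite /= !inE !negb_or (single_neq yz).
  have neq u v : one_way u v -> u != v.
    by move=> /one_way_single; apply: single_neq.
  by rewrite !(eq_sym _ q) (digon_neq qr) !neq.
have [H [f [t [f_inj fE cardH ft]]]] := induced_on_seq Us isT.
case: t ft => [|v1 [|v2 [|v3 [|v4 [|]]]]] //= [e1 e2 e3 e4].
subst y z r q; apply: (@F1_free H); last by exists f.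
apply: Or43; split=> //; exists v1, v2, v3, v4.
rewrite -(map_inj_uniq f_inj); split=> //.
move: qr zr qy yr qz yz; rewrite digonC /digon /single_arc /one_way !fE.
by do 6!move=> ->.
Qed.

Lemma no_directed_triangle x y z : one_way x y -> one_way y z -> ~~ one_way z x.
Proof.
move=> xy yz; apply/negP => zx.
have Us : uniq [:: x; y; z].
  rewrite /= !inE !negb_or (single_neq (one_way_single xy)).
  rewrite (single_neq (one_way_single yz)) eq_sym.
  by rewrite (single_neq (one_way_single zx)).
have [H [f [t [f_inj fE cardH ft]]]] := induced_on_seq Us isT.
case: t ft => [|v1 [|v2 [|v3 [|]]]] //= [e1 e2 e3].
subst x y z; apply: (@F1_free H); last by exists f.
apply: Or44; split=> //; exists v1, v2, v3.
rewrite -(map_inj_uniq f_inj); split=> //.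
by move: xy yz zx; rewrite /one_way !fE => -> ->.
Qed.

(** Weak quasi-transitivity makes the ends of the path adjacent, so only a digon
    or a directed triangle could prevent the shortcut. *)
Lemma one_way_trans x y z :
  one_way x y -> one_way y z -> ~~ digon x z -> one_way x z.
Proof.
move=> xy yz xz.
have /adjacent_single/(_ xz)/orP[//|zx] := one_way_path_adjacent xy yz.
by case/negP: (no_directed_triangle xy yz).
Qed.

End ForbiddenConfigurations.

(** * Minimal elements of a finite strict order *)

Section Minimal.
Set Implicit Arguments.
Unset Strict Implicit.

Lemma exists_minimal (T : finType) (P : pred T) (r : rel T) (x : T) :
  irreflexive r ->
  (forall y z t, P y -> P z -> P t -> r y z -> r z t -> r y t) ->
  P x -> exists2 y, P y & forall z, P z -> ~~ r z y.
Proof.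
move=> r_irr r_trans Px.
case: (arg_minnP (fun y => #|[set z | P z & r z y]|) Px) => y Py y_min.
exists y => // z Pz; apply/negP => rzy.
have := y_min z Pz; rewrite leqNgt proper_card //.
apply/properP; split; last by exists z; rewrite !inE Pz ?rzy ?r_irr.
apply/subsetP => t; rewrite !inE => /andP[Pt rtz].
by rewrite Pt (r_trans t z y).
Qed.

End Minimal.

(** * Sufficiency *)

Section Sufficiency.
Set Implicit Arguments.
Unset Strict Implicit.
Variable D : digraph.
Hypothesis D_wqt : weakly_quasi_transitive D.
Hypothesis SD_chordal : semi_strict_chordal (symmetric_part D).
Hypothesis F1_free : forall H : digraph, family_F1 H -> ~ contains_induced D H.
Implicit Types a b c d m u v w x y z : D.

Lemma exists_simplicial (A : {set D}) : A != set0 ->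
  exists2 v, v \in A & forall u w, u \in A -> w \in A ->
    digon v u -> digon v w -> u != w -> digon u w.
Proof.
move=> A_neq0; have [v vA v_dis] := (chordalP _).1 SD_chordal A A_neq0.
exists v => // u w uA wA vu vw neq_uw.
by have /andP[] := v_dis u w uA wA (digon_sym vu) vw neq_uw.
Qed.

(** A chordal graph has no induced cycle of length four. *)
Lemma symmetric_four_cycle a b c d :
  digon a b -> digon b c -> digon c d -> digon d a -> a != c -> b != d ->
  ~~ digon a c -> digon b d.
Proof.
move=> ab bc cd da neq_ac neq_bd nac; apply: contraT => nbd.
have A_neq0 : [set a; b; c; d] != set0.
  by apply/set0Pn; exists a; rewrite !inE eqxx.
have [v vA disE] := exists_simplicial A_neq0.
move: vA; rewrite !inE -!orbA => /or4P[] /eqP ev.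
- by case/negP: nbd; apply: disE; rewrite ?inE ?eqxx ?orbT ?ev // digonC.
- by case/negP: nac; apply: disE; rewrite ?inE ?eqxx ?orbT ?ev // digonC.
- by case/negP: nbd; apply: disE; rewrite ?inE ?eqxx ?orbT ?ev // digonC.
- by case/negP: nac; apply: disE; rewrite ?inE ?eqxx ?orbT ?ev // digonC.
Qed.

Section InducedOn.
Variable A : {set D}.

Definition single_end v := [exists w in A, single_arc v w].

Definition lonely y :=
  [&& y \in A, single_end y & [forall z in A, digon y z ==> ~~ single_end z]].

Lemma single_endI v w : w \in A -> single_arc v w -> single_end v.
Proof. by move=> wA vw; apply/exists_inP; exists w. Qed.

Lemma lonely_in y : lonely y -> y \in A.
Proof. by case/and3P. Qed.

Lemma lonely_not_digon y z :
  lonely y -> z \in A -> single_end z -> ~~ digon y z.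
Proof.
case/and3P=> _ _ /forall_inP y_alone zA; apply: contraL.
exact/implyP/y_alone.
Qed.

Lemma not_lonely v : v \in A -> single_end v -> ~~ lonely v ->
  exists z, [/\ z \in A, digon v z & single_end z].
Proof.
move=> vA v_end; rewrite /lonely vA v_end /= negb_forall_in.
by case/exists_inP=> z zA; rewrite negb_imply negbK => /andP[]; exists z.
Qed.

(** The ends of a single arc cannot be told apart by a vertex without single
    arcs: [y] and [z] are adjacent as asynchronous neighbours of [x], and an
    adjacency at [z] can only be a digon. *)
Lemma digon_to_clean x y z : y \in A ->
  single_arc x y -> digon x z -> ~~ single_end z -> digon y z.
Proof.
move=> yA xy xz z_clean; apply: contraNT z_clean => nyz.
apply: (single_endI yA); rewrite single_arcC; apply: adjacent_single nyz.
by apply: (single_digon_adjacent D_wqt (v := x)); rewrite // single_arcC.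
Qed.

(** An end [m] of single arcs with the most digons is joined by single arcs to
    lonely vertices only. Suppose that [x] is such a neighbour of [m] and that
    [z], which forms a digon with [x], is an end of a single arc. If [m] and
    [z] do not form a digon, maximality gives [u] with a digon to [m] and none
    to [x], and [m], [z], [u], [x] form type (a). If they do, both [x] and [m]
    count for [z] while neither counts for [m], so maximality gives [u] with a
    digon to [m] and none to [z]: either [x] and [u] form a digon, and [m],
    [u], [x], [z] is an induced four-cycle of S(D), or these four vertices form
    type (a). *)
Lemma exists_lonely x : x \in A -> single_end x -> exists y, lonely y.
Proof.
move=> xA x_end; pose dn v := [set z in A | digon v z].
have Px : [pred v in A | single_end v] x by rewrite /= xA.
case: (arg_maxnP (fun v => #|dn v|) Px) => m /= /andP[mA m_end] m_max.
move=> {x Px xA x_end}.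
have [x xA mx] := exists_inP m_end.
have x_end : single_end x by apply: (single_endI mA); rewrite single_arcC.
exists x; apply: contraT => /(not_lonely xA x_end)[z [zA xz z_end]].
have adj_m u : digon m u -> adjacent x u.
  by apply: (single_digon_adjacent D_wqt); rewrite single_arcC.
have mz : digon m z.
  apply: contraT => nmz.
  have s_mz : single_arc m z.
    exact: adjacent_single (single_digon_adjacent D_wqt mx xz) nmz.
  have /subsetPn[u] : ~~ (dn m \subset dn x).
    apply/negP => sub_mx; have := m_max x; rewrite xA x_end /= => /(_ isT).
    rewrite leqNgt proper_card //; apply/properP; split=> //.
    by exists z; rewrite !inE ?zA ?xz // (negPf nmz) andbF.
  rewrite !inE => /andP[uA mu]; rewrite uA /= => nxu.
  have s_xu := adjacent_single (adj_m u mu) nxu.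
  have := no_alternating_cycle D_wqt F1_free mu (digon_sym xz) s_mz.
  by rewrite single_arcC s_xu.
have nmx := single_not_digon mx.
(* [dn m] has the element [z] that [dn z] lacks, and [dn z] has the two
   elements [m] and [x] that [dn m] lacks: were the rest of [dn m] contained
   in [dn z], the set [dn z] would be the larger one. *)
have /subsetPn[u] : ~~ (dn m :\ z \subset dn z :\ m :\ x).
  apply/negP => /subset_leq_card; rewrite leqNgt.
  have := m_max z; rewrite zA z_end /= => /(_ isT) le_zm.
  have z_m : z \in dn m by rewrite !inE zA.
  have m_z : m \in dn z by rewrite !inE mA digonC.
  have x_z : x \in dn z :\ m.
    by rewrite !inE eq_sym single_neq // xA digonC.
  move: le_zm; rewrite (cardsD1 z (dn m)) z_m (cardsD1 m (dn z)) m_z.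
  by rewrite (cardsD1 x (dn z :\ m)) x_z !add1n !ltnS => ->.
rewrite !inE => /and3P[neq_uz uA mu].
have neq_ux : u != x by apply: contraNneq nmx => <-.
have neq_um : u != m by rewrite eq_sym digon_neq.
rewrite neq_ux neq_um uA /= => nzu.
have nxu : ~~ digon x u.
  apply: contraNN nzu => xu; rewrite digonC.
  apply: (@symmetric_four_cycle m u x z); rewrite // 1?digonC //.
  exact: single_neq.
have s_xu := adjacent_single (adj_m u mu) nxu.
have s_uz : single_arc u z.
  rewrite single_arcC; apply: adjacent_single nzu; rewrite adjacentC.
  by apply: (single_digon_adjacent D_wqt _ xz); rewrite single_arcC.
have := no_alternating_cycle D_wqt F1_free (digon_sym mu) (digon_sym xz) s_uz.
by rewrite mx.
Qed.

(** Let [x] be the other end of a single arc at [y]. Two vertices forming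
    digons with [y] both form digons with [x] as well; with [y] and [x] they
    make a four-cycle of S(D) without the diagonal [y x], so they form a
    digon. *)
Lemma lonely_disimplicial y : lonely y ->
  (forall u w, u \in A -> w \in A -> one_way u y -> one_way y w -> digon u w) ->
  disimplicial_in A y.
Proof.
move=> y_lonely path_digon u w uA wA uy yw neq_uw.
have [yA y_end y_alone] := and3P y_lonely.
have clean z : z \in A -> digon y z -> ~~ single_end z.
  by move=> zA; apply/implyP; apply: (forall_inP y_alone).
have to_clean v z :
    v \in A -> z \in A -> single_arc y v -> digon y z -> digon v z.
  by move=> vA zA yv yz; apply: (digon_to_clean vA yv yz); apply: clean.
have [yu|nyu] := boolP (digon y u); have [dyw|nyw] := boolP (digon y w).
- have [x xA yx] := exists_inP y_end.
  apply: (@symmetric_four_cycle y u x w) => //.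
  + by rewrite digonC to_clean.
  + exact: to_clean.
  + by rewrite digonC.
  + exact: single_neq.
  + exact: single_not_digon.
- rewrite digonC to_clean //; apply: adjacent_single nyw.
  by rewrite /adjacent yw.
- rewrite to_clean //; apply: adjacent_single nyu.
  by rewrite /adjacent uy orbT.
by apply: path_digon; rewrite // darc_one_way // digonC.
Qed.

(** Not being lonely, [c] and [c'] form digons with further ends [d] and [d'] of
    single arcs, and all four are joined to [y] by single arcs because [y] is
    lonely. If [c c'] were not a digon it would be a one-way arc. An end
    of single arcs forming digons with both [c] and [c'] would then give type
    (b); so [c d'] and [d c'] are single arcs, giving type (a) on the digons
    [c d] and [c' d']. *)
Lemma one_way_lonely_path y c c' : lonely y -> c \in A -> c' \in A ->
  ~~ lonely c -> ~~ lonely c' -> one_way c y -> one_way y c' -> digon c c'.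
Proof.
move=> y_lonely cA c'A c_nl c'_nl cy yc'; have yA := lonely_in y_lonely.
have [s_cy s_yc'] := (one_way_single cy, one_way_single yc').
have c_end : single_end c := single_endI yA s_cy.
have c'_end : single_end c' by apply: (single_endI yA); rewrite single_arcC.
have [d [dA cd d_end]] := not_lonely cA c_end c_nl.
have [d' [d'A c'd' d'_end]] := not_lonely c'A c'_end c'_nl.
apply: contraT => ncc'.
have cc' := one_way_trans D_wqt F1_free cy yc' ncc'.
have no_common e : e \in A -> single_end e -> digon c e -> ~~ digon c' e.
  move=> eA e_end ce; apply/negP => c'e.
  apply: (no_type_b F1_free (digon_sym ce) (digon_sym c'e) cc' cy yc').
  rewrite single_arcC; apply: adjacent_single; last exact: lonely_not_digon.
  by apply: (single_digon_adjacent D_wqt _ ce); rewrite single_arcC.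
have s_cc' := one_way_single cc'.
have s_cd' : single_arc c d'.
  apply: adjacent_single; first exact: (single_digon_adjacent D_wqt s_cc').
  by apply: contraTN c'd' => /(no_common _ d'A d'_end).
have s_dc' : single_arc d c'.
  rewrite single_arcC; apply: adjacent_single; last exact: no_common.
  by apply: (single_digon_adjacent D_wqt _ cd); rewrite single_arcC.
have := no_alternating_cycle D_wqt F1_free cd (digon_sym c'd') s_cd'.
by rewrite s_dc'.
Qed.

(** Both ends of the path are ends of single arcs, so a digon between them is
    impossible when one of them is lonely. *)
Lemma one_way_trans_lonely x y z :
  y \in A -> z \in A -> (lonely x || lonely z) -> x \in A ->
  one_way x y -> one_way y z -> one_way x z.
Proof.
move=> yA zA xz_lonely xA xy yz; apply: (one_way_trans D_wqt F1_free xy yz).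
have x_end : single_end x := single_endI yA (one_way_single xy).
have z_end : single_end z.
  by apply: (single_endI yA); rewrite single_arcC one_way_single.
case/orP: xz_lonely => [x_lonely|z_lonely]; first exact: lonely_not_digon.
by rewrite digonC lonely_not_digon.
Qed.

Lemma disimplicial_of_single_arc x : x \in A -> single_end x ->
  exists2 v, v \in A & disimplicial_in A v.
Proof.
have irr : irreflexive (@one_way D).
  by move=> v; rewrite /one_way darc_irreflexive.
move=> xA x_end; have [y0 y0_lonely] := exists_lonely xA x_end.
have lonely_trans u v w : lonely u -> lonely v -> lonely w ->
    one_way u v -> one_way v w -> one_way u w.
  move=> u_l v_l w_l; apply: one_way_trans_lonely; rewrite ?u_l ?lonely_in //.
have [y y_lonely y_min] := exists_minimal irr lonely_trans y0_lonely.
have yA := lonely_in y_lonely.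
have [all_digon|] := boolP [forall u in A, forall w in A,
    one_way u y ==> one_way y w ==> digon u w].
  exists y => //; apply: lonely_disimplicial => // u w uA wA uy yw.
  by have /forall_inP/(_ w wA) := forall_inP all_digon u uA; rewrite uy yw.
rewrite negb_forall_in => /exists_inP[c cA]; rewrite negb_forall_in.
case/exists_inP=> w wA; rewrite !negb_imply => /and3P[cy yw ncw].
have c_nl : ~~ lonely c by apply: contraL cy; apply: y_min.
have w_lonely : lonely w.
  by apply: contraNT ncw => w_nl; apply: one_way_lonely_path cy yw.
(* Maximality of [t] is minimality for the reversed arcs. *)
have [t /andP[t_lonely yt] t_max] :
    exists2 t, lonely t && one_way y t &
      forall z, lonely z && one_way y z -> ~~ one_way t z.
  apply: (@exists_minimal _ _ (fun u v => one_way v u) w) => //.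
    move=> u v z /andP[u_l _] /andP[v_l _] /andP[z_l _] vu zv.
    exact: (lonely_trans z v u).
  by rewrite w_lonely.
have tA := lonely_in t_lonely.
have [/exists_inP[c' c'A tc']|no_out] := boolP [exists c' in A, one_way t c'];
  last first.
  exists t => //; apply: lonely_disimplicial => // u v uA vA _ tv.
  by case/exists_inP: no_out; exists v.
have yc' : one_way y c' by apply: one_way_trans_lonely yt tc'; rewrite ?y_lonely.
have c'_nl : ~~ lonely c'.
  by apply: contraL tc' => c'_l; apply: t_max; rewrite c'_l.
have cc' := one_way_lonely_path y_lonely cA c'A c_nl c'_nl cy yc'.
have ct : one_way c t.
  by apply: one_way_trans_lonely cy yt; rewrite ?t_lonely ?orbT.
(* [c] dominates [y] and [t], which both dominate [c'], so that the arc from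
   [y] to [t] completes type (c). *)
case/negP: (no_type_c F1_free cc' cy ct yc' tc').
exact: one_way_single.
Qed.

End InducedOn.

Lemma chordal_of_symmetric_part : semi_strict_chordal D.
Proof.
apply/chordalP => A A_neq0.
have [/exists_inP[x]|no_single] := boolP [exists x in A, single_end A x].
  exact: disimplicial_of_single_arc.
have darc_digon u v : u \in A -> v \in A -> darc u v -> digon u v.
  move=> uA vA uv; apply: contraNT no_single => nuv.
  apply/exists_inP; exists u => //; apply: (single_endI vA).
  by apply: adjacent_single; rewrite // /adjacent uv.
have [v vA v_dis] := exists_simplicial A_neq0.
exists v => // u w uA wA uv vw; apply: v_dis => //; last exact: darc_digon.
exact/digon_sym/darc_digon.
Qed.

End Sufficiency.

Theorem theorem3 (D : digraph) (D_wqt : weakly_quasi_transitive D) :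
  semi_strict_chordal D <->
  semi_strict_chordal (symmetric_part D) /\
  (forall H : digraph, family_F1 H -> ~ contains_induced D H).
Proof.
split=> [D_chordal | [SD_chordal F1_free]].
  split=> [|H F1H]; first exact: chordal_symmetric_part.
  move=> /(chordal_contains_disimplicial D_chordal)[v].
  exact: F1_no_disimplicial.
exact: chordal_of_symmetric_part.
Qed.
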